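(* Let $\mathfrak{A}$ be a structure with domain $A$. Then $\mathfrak{A}$ has an elementary extension $\mathfrak{A}^*$ such that the following holds. If $\mathfrak{B}$ is a first-order reduct of $\mathfrak{A}$ and $K\subseteq A^k$ is first-order definable over $\mathfrak{A}$, then - $K$ has an existential positive definition in $\mathfrak{B}$ if and only if $K^*$ is preserved by all endomorphisms of $\mathfrak{B}^*$; - $K$ has a positive definition in $\mathfrak{B}$ if and only if $K^*$ is preserved by all surjective endomorphisms of $\mathfrak{B}^*$; - $K$ has a first-order definition in $\mathfrak{B}$ if and only if $K^*$ is preserved by all automorphisms of $\mathfrak{B}^*$. Here, $\mathfrak{B}^*$ is the first-order reduct of $\mathfrak{A}^*$ defined by the same formulas as the first-order reduct $\mathfrak{B}$ of $\mathfrak{A}$, and $K^*$ is the relation defined over $\mathfrak{A}^*$ by the same first-order formula that defines $K$ over $\mathfrak{A}$.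
   Context: Structures have signatures consisting of function symbols (possibly of arity $0$, i.e. constants) and relation symbols. Definability is without parameters: formulas use only symbols of the signature. Atomic formulas are $\bot$ (false), $t_1=t_2$ for terms $t_1,t_2$, and $R(t_1,\dots,t_k)$ for a relation symbol $R$ and terms $t_i$. First-order formulas are built from atomic formulas using $\wedge,\vee,\neg,\forall,\exists$. A first-order formula is positive if it is built without negation, i.e. from atomic formulas by existential and universal quantification, conjunction and disjunction; it is existential positive if it is built without negation and without universal quantification. A formula defines an operation if it defines its graph. If $\mathfrak{A}$ and $\mathfrak{B}$ have the same domain and $\mathfrak{A}$ is obtained from $\mathfrak{B}$ by dropping some relations and operations, then $\mathfrak{A}$ is a reduct of $\mathfrak{B}$ and $\mathfrak{B}$ an expansion of $\mathfrak{A}$. $\mathfrak{B}$ is a first-order reduct of $\mathfrak{A}$ if $\mathfrak{B}$ is a reduct of an expansion of $\mathfrak{A}$ by relations and operations that are first-order definable in $\mathfrak{A}$. A map $h$ from a set to itself preserves a $k$-ary relation $K$ on that set if $(h(a_1),\dots,h(a_k))\in K$ whenever $(a_1,\dots,a_k)\in K$. *)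

(* Defs.v *)
From mathcomp Require Export all_boot.

Set Implicit Arguments.
Unset Strict Implicit.
Unset Printing Implicit Defensive.

(** * First-order logic *)

(* Function symbols of arity 0 are the constants; the sets of symbols may be
   infinite. *)
Record signature := Signature {
  fsym : Type;
  rsym : Type;
  farity : fsym -> nat;
  rarity : rsym -> nat
}.

(* A structure is identified with its interpretation on a fixed domain [A], so
   that "[M] and [N] have the same domain" is expressed by the types. *)
Record structure (sg : signature) (A : Type) := Structure {
  fint : forall f : fsym sg, ('I_(farity f) -> A) -> A;
  rint : forall r : rsym sg, ('I_(rarity r) -> A) -> Prop
}.

Inductive term (sg : signature) (n : nat) : Type :=
| Var of 'I_n
| App (f : fsym sg) of ('I_(farity f) -> term sg n).

(* [form sg n]: formulas whose free variables are among n variables, indexed by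
   'I_n. Variables are de Bruijn indices: in the body of a quantifier, index 0
   is the bound variable and index i.+1 is the outer variable i. *)
Inductive form (sg : signature) : nat -> Type :=
| Bot n : form sg n
| Eq n of term sg n & term sg n : form sg n
| Rel n (r : rsym sg) of ('I_(rarity r) -> term sg n) : form sg n
| And n of form sg n & form sg n : form sg n
| Or n of form sg n & form sg n : form sg n
| Neg n of form sg n : form sg n
| Forall n of form sg n.+1 : form sg n
| Exists n of form sg n.+1 : form sg n.

Definition vcons (A : Type) (n : nat) (a : A) (v : 'I_n -> A) : 'I_n.+1 -> A :=
  fun i => if unlift ord0 i is Some j then v j else a.

Fixpoint eval (sg : signature) (A : Type) (M : structure sg A) (n : nat)
    (v : 'I_n -> A) (t : term sg n) : A :=
  match t with
  | Var i => v i
  | App f ts => fint M (fun i => eval M v (ts i))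
  end.

Fixpoint sat (sg : signature) (A : Type) (M : structure sg A) (n : nat)
    (p : form sg n) : ('I_n -> A) -> Prop :=
  match p in form _ m return ('I_m -> A) -> Prop with
  | Bot _ => fun _ => False
  | Eq _ s t => fun v => eval M v s = eval M v t
  | Rel _ r ts => fun v => rint M (fun i => eval M v (ts i))
  | And _ p q => fun v => sat M p v /\ sat M q v
  | Or _ p q => fun v => sat M p v \/ sat M q v
  | Neg _ p => fun v => ~ sat M p v
  | Forall _ p => fun v => forall a : A, sat M p (vcons a v)
  | Exists _ p => fun v => exists a : A, sat M p (vcons a v)
  end.

Fixpoint positive (sg : signature) (n : nat) (p : form sg n) : bool :=
  match p with
  | Bot _ | Eq _ _ _ | Rel _ _ _ => true
  | And _ p q | Or _ p q => positive p && positive q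
  | Neg _ _ => false
  | Forall _ p | Exists _ p => positive p
  end.

Fixpoint existential_positive (sg : signature) (n : nat) (p : form sg n) : bool :=
  match p with
  | Bot _ | Eq _ _ _ | Rel _ _ _ => true
  | And _ p q | Or _ p q => existential_positive p && existential_positive q
  | Neg _ _ | Forall _ _ => false
  | Exists _ p => existential_positive p
  end.

(** * Definability *)

Definition defines (sg : signature) (A : Type) (M : structure sg A) (k : nat)
    (p : form sg k) (K : ('I_k -> A) -> Prop) : Prop :=
  forall v : 'I_k -> A, K v <-> sat M p v.

(* In a formula for the graph of a k-ary operation, variable 0 is the value and
   variables 1, .., k are the arguments. *)
Definition defines_op (sg : signature) (A : Type) (M : structure sg A) (k : nat)
    (p : form sg k.+1) (F : ('I_k -> A) -> A) : Prop :=
  forall (v : 'I_k -> A) (a : A), F v = a <-> sat M p (vcons a v).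

Definition fo_definable (sg : signature) (A : Type) (M : structure sg A)
    (k : nat) (K : ('I_k -> A) -> Prop) : Prop :=
  exists p : form sg k, defines M p K.

Definition pos_definable (sg : signature) (A : Type) (M : structure sg A)
    (k : nat) (K : ('I_k -> A) -> Prop) : Prop :=
  exists2 p : form sg k, positive p & defines M p K.

Definition ep_definable (sg : signature) (A : Type) (M : structure sg A)
    (k : nat) (K : ('I_k -> A) -> Prop) : Prop :=
  exists2 p : form sg k, existential_positive p & defines M p K.

(* For each symbol of [tau], a defining formula over [sg]. *)
Record definitions (sg tau : signature) := Definitions {
  fdef : forall f : fsym tau, form sg (farity f).+1;
  rdef : forall r : rsym tau, form sg (rarity r)
}.

(* [B] is the first-order reduct of [M] defined by the formulas [D]. A symbol
   that [B] inherits from [M] is covered too: it is defined by the corresponding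
   atomic formula. *)
Definition fo_reduct_by (sg tau : signature) (D : definitions sg tau) (A : Type)
    (M : structure sg A) (B : structure tau A) : Prop :=
  (forall f : fsym tau, defines_op M (fdef D f) (@fint tau A B f)) /\
  (forall r : rsym tau, defines M (rdef D r) (@rint tau A B r)).

(** * Maps *)

(* An elementary extension of [M] is given by a structure [N] together with an
   elementary embedding [e] along which [A] is identified with a subset of the
   domain of [N]. Injectivity of [e] follows from the formula x = y. *)
Definition elementary_embedding (sg : signature) (A A' : Type)
    (M : structure sg A) (N : structure sg A') (e : A -> A') : Prop :=
  forall (n : nat) (p : form sg n) (v : 'I_n -> A), sat M p v <-> sat N p (e \o v).

Definition preserves (A : Type) (h : A -> A) (k : nat) (K : ('I_k -> A) -> Prop) :
    Prop :=
  forall v : 'I_k -> A, K v -> K (h \o v).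

Definition endomorphism (sg : signature) (A : Type) (M : structure sg A)
    (h : A -> A) : Prop :=
  (forall (f : fsym sg) (v : 'I_(farity f) -> A),
      h (fint M v) = fint M (h \o v)) /\
  (forall r : rsym sg, preserves h (@rint sg A M r)).

Definition surjective_map (A : Type) (h : A -> A) : Prop :=
  forall y : A, exists x : A, h x = y.

Definition automorphism (sg : signature) (A : Type) (M : structure sg A)
    (h : A -> A) : Prop :=
  endomorphism M h /\
  exists g : A -> A, [/\ cancel h g, cancel g h & endomorphism M g].

(* Main.v *)
Require Import Defs.
From mathcomp Require Import boolp filter.

(* The extension is the union M' of an elementary chain M = M_0 < M_1 < ... in
   which M_(n+1) realizes every type over M_n in as many unknowns as M_n has
   elements; each step is a single ultrapower.
   Such unions behave like special models without any cardinal arithmetic: a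
   relation P on M_n along which a class of formulas transfers can be extended so
   that its domain contains all of M_n, by realizing one type in M_(n+1).
   If K is not definable in the fragment F (existential positive, positive, all
   formulas), there are a in K* and b outside K* in M_1 such that b satisfies all
   F-formulas of B* true at a. Iterating the extension of the relation a_i -> b_i
   gives an F-preserving map of M' violating K*. If F is closed under universal
   quantification, negations of F-formulas transfer along the inverse relation,
   and alternating forth and back steps makes the map surjective. The approximations
   must be relations: for positive formulas the map need not be injective, so its
   inverse is not a function. *)

Set Implicit Arguments.
Unset Strict Implicit.
Unset Printing Implicit Defensive.

(** * Tuples and their concatenation *)

Definition vnil (A : Type) (i : 'I_0) : A := False_rect A (notF (ltn_ord i)).

Definition vcat (A : Type) m n (w : 'I_m -> A) (v : 'I_n -> A) : 'I_(m + n) -> A :=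
  fun i => match split i with inl j => w j | inr j => v j end.

Lemma vcons0 (A : Type) n (a : A) (v : 'I_n -> A) : vcons a v ord0 = a.
Proof. by rewrite /vcons unlift_none. Qed.

Lemma vconsS (A : Type) n (a : A) (v : 'I_n -> A) i : vcons a v (lift ord0 i) = v i.
Proof. by rewrite /vcons liftK. Qed.

Lemma comp_vcons (A A' : Type) (f : A -> A') n (a : A) (v : 'I_n -> A) :
  f \o vcons a v = vcons (f a) (f \o v).
Proof. by apply: funext => i; rewrite /vcons /=; case: unlift. Qed.

Lemma vcons_comp (A : Type) n m (a : A) (v : 'I_n -> A) (r : 'I_m -> 'I_n) :
  vcons a v \o vcons ord0 (lift ord0 \o r) = vcons a (v \o r).
Proof. by rewrite comp_vcons vcons0; congr vcons; apply: funext => i /=; rewrite vconsS. Qed.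

Lemma vcons_eta (A : Type) n (v : 'I_n.+1 -> A) : v = vcons (v ord0) (v \o lift ord0).
Proof.
apply: funext => i; case: (unliftP ord0 i) => [j|] ->; first by rewrite vconsS.
by rewrite vcons0.
Qed.

Lemma vcat_l (A : Type) m n (w : 'I_m -> A) (v : 'I_n -> A) i : vcat w v (lshift n i) = w i.
Proof. by rewrite /vcat -[lshift n i]/(unsplit (inl i)) unsplitK. Qed.

Lemma vcat_r (A : Type) m n (w : 'I_m -> A) (v : 'I_n -> A) i : vcat w v (rshift m i) = v i.
Proof. by rewrite /vcat -[rshift m i]/(unsplit (inr i)) unsplitK. Qed.

Lemma vcatP (A : Type) m n (v : 'I_(m + n) -> A) : v = vcat (v \o @lshift m n) (v \o @rshift m n).
Proof.
apply: funext => i; case: (splitP i) => j e.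
  by rewrite (_ : i = lshift n j) ?vcat_l //; apply: val_inj.
by rewrite (_ : i = rshift m j) ?vcat_r //; apply: val_inj.
Qed.

Lemma comp_vcat (A A' : Type) (f : A -> A') m n (w : 'I_m -> A) (v : 'I_n -> A) :
  f \o vcat w v = vcat (f \o w) (f \o v).
Proof. by apply: funext => i; rewrite /vcat /=; case: split. Qed.

Lemma vcat0 (A : Type) n (w : 'I_0 -> A) (v : 'I_n -> A) : vcat w v = v.
Proof.
by apply: funext => i; rewrite -[in LHS](_ : @rshift 0 n i = i) ?vcat_r //; apply: val_inj.
Qed.

Lemma vcat_vcons (A : Type) m n (a : A) (w : 'I_m -> A) (v : 'I_n -> A) :
  vcat (vcons a w) v = vcons a (vcat w v) :> ('I_(m + n).+1 -> A).
Proof.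
rewrite [RHS](@vcatP A m.+1 n); apply: (f_equal2 (@vcat A m.+1 n)); apply: funext => i /=.
- case: (unliftP ord0 i) => [j|] ->.
    have -> : lshift n (lift ord0 j) = lift ord0 (@lshift m n j) :> 'I_(m + n).+1.
      exact: val_inj.
    by rewrite !vconsS vcat_l.
  have -> : lshift n (@ord0 m) = ord0 :> 'I_(m + n).+1 by exact: val_inj.
  by rewrite !vcons0.
- have -> : rshift m.+1 i = lift ord0 (@rshift m n i) :> 'I_(m + n).+1 by exact: val_inj.
  by rewrite vconsS vcat_r.
Qed.

(** * Renaming of variables, blocks of existential quantifiers, finite conjunctions *)

Fixpoint trename (sg : signature) m n (r : 'I_m -> 'I_n) (t : term sg m) : term sg n :=
  match t with
  | Var i => Var sg (r i)
  | App f ts => App (fun i => trename r (ts i))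
  end.

Fixpoint rename (sg : signature) m (p : form sg m) :
    forall n, ('I_m -> 'I_n) -> form sg n :=
  match p in form _ m return forall n, ('I_m -> 'I_n) -> form sg n with
  | Bot _ => fun n r => Bot sg n
  | Eq _ s t => fun n r => Eq (trename r s) (trename r t)
  | Rel _ R ts => fun n r => Rel (fun i => trename r (ts i))
  | And _ p q => fun n r => And (rename p r) (rename q r)
  | Or _ p q => fun n r => Or (rename p r) (rename q r)
  | Neg _ p => fun n r => Neg (rename p r)
  | Forall _ p => fun n r => Forall (rename p (vcons ord0 (lift ord0 \o r)))
  | Exists _ p => fun n r => Exists (rename p (vcons ord0 (lift ord0 \o r)))
  end.

Lemma eval_trename sg A (M : structure sg A) m n (r : 'I_m -> 'I_n) v t :
  eval M v (trename r t) = eval M (v \o r) t.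
Proof. by elim: t => //= f ts IH; congr fint; apply: funext => i. Qed.

Lemma sat_rename sg A (M : structure sg A) m (p : form sg m) n (r : 'I_m -> 'I_n) v :
  sat M (rename p r) v = sat M p (v \o r).
Proof.
elim: p n r v => {m} //=.
- by move=> m s t n r v; rewrite !eval_trename.
- by move=> m R ts n r v; congr rint; apply: funext => i; rewrite eval_trename.
- by move=> m p IHp q IHq n r v; rewrite IHp IHq.
- by move=> m p IHp q IHq n r v; rewrite IHp IHq.
- by move=> m p IHp n r v; rewrite IHp.
- by move=> m p IHp n r v; apply: eq_forall => a; rewrite IHp vcons_comp.
- by move=> m p IHp n r v; apply: eq_exists => a; rewrite IHp vcons_comp.
Qed.

Lemma sat_And sg A (M : structure sg A) n (p q : form sg n) v :
  sat M (And p q) v = (sat M p v /\ sat M q v).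
Proof. by []. Qed.

(** Truth written without [Neg], hence existential positive; it holds on nonempty domains, which is
    why points such as [a0] accompany it. *)
Definition top (sg : signature) n : form sg n := Exists (Eq (Var sg ord0) (Var sg ord0)).

Fixpoint exn (sg : signature) m n : form sg (m + n) -> form sg n :=
  match m return form sg (m + n) -> form sg n with
  | 0 => fun p => p
  | m'.+1 => fun p => @exn sg m' n (Exists p)
  end.

Lemma sat_exn sg A (M : structure sg A) m n (p : form sg (m + n)) v :
  sat M (exn p) v <-> exists w : 'I_m -> A, sat M p (vcat w v).
Proof.
elim: m p => [|m IH] p.
  split=> [Hp|[w]]; last by rewrite vcat0.
  by exists (@vnil A); rewrite vcat0.
rewrite IH /=; split=> [[w [a Hp]]|[w Hp]].
  by exists (vcons a w); rewrite vcat_vcons.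
by exists (w \o lift ord0), (w ord0); rewrite -vcat_vcons -vcons_eta.
Qed.

Definition bigand (sg : signature) n k (F : 'I_k -> form sg n) : form sg n :=
  foldr (fun i => And (F i)) (Neg (Bot sg n)) (enum 'I_k).

Lemma sat_bigand sg A (M : structure sg A) n k (F : 'I_k -> form sg n) v :
  sat M (bigand F) v <-> forall i, sat M (F i) v.
Proof.
have: sat M (bigand F) v <-> forall i, i \in enum 'I_k -> sat M (F i) v.
  rewrite /bigand; elim: (enum _) => [|j s IH] /=; first by split=> // _ [].
  rewrite IH; split=> [[Hj Hs] i|H]; last first.
    by split=> [|i si]; apply: H; rewrite inE ?eqxx ?si ?orbT.
  by rewrite inE => /orP[/eqP ->|/Hs].
by move=> ->; split=> H i => [|_]; apply: H; rewrite mem_enum.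
Qed.

(** * Translating along a first-order reduct *)

Section Translation.
Context (sg tau : signature) (D : definitions sg tau).

(* Function symbols of [tau] are only given by their graphs, so a term is
   translated to the graph of its value: variable 0 is the value of the term. *)
Fixpoint tgraph n (t : term tau n) : form sg n.+1 :=
  match t with
  | Var i => Eq (Var sg ord0) (Var sg (lift ord0 i))
  | App f ts =>
      @exn sg (farity f) n.+1
        (And (bigand (fun i => rename (tgraph (ts i))
                (vcons (lshift n.+1 i) (@rshift (farity f) n.+1 \o lift ord0))))
             (rename (fdef D f)
                (vcons (rshift (farity f) ord0) (@lshift (farity f) n.+1))))
  end.

Fixpoint translate n (p : form tau n) : form sg n :=
  match p in form _ m return form sg m with
  | Bot n => Bot sg n
  | Eq n s t => Exists (And (tgraph s) (tgraph t))
  | Rel n r ts =>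
      @exn sg (rarity r) n
        (And (bigand (fun i => rename (tgraph (ts i))
                (vcons (lshift n i) (@rshift (rarity r) n))))
             (rename (rdef D r) (@lshift (rarity r) n)))
  | And _ p q => And (translate p) (translate q)
  | Or _ p q => Or (translate p) (translate q)
  | Neg _ p => Neg (translate p)
  | Forall _ p => Forall (translate p)
  | Exists _ p => Exists (translate p)
  end.

Context (A : Type) (M : structure sg A) (B : structure tau A).
Hypothesis MB : fo_reduct_by D M B.

Lemma sat_tgraph n (t : term tau n) a v :
  sat M (tgraph t) (vcons a v) <-> eval B v t = a.
Proof.
elim: t a => [i|f ts IH] a; first by rewrite /= vcons0 vconsS.
rewrite [tgraph _]/= sat_exn.
have E w i : sat M (rename (tgraph (ts i))
      (vcons (lshift n.+1 i) (@rshift (farity f) n.+1 \o lift ord0)))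
      (vcat w (vcons a v)) <-> eval B v (ts i) = w i.
  rewrite sat_rename comp_vcons vcat_l -IH.
  rewrite (_ : _ \o _ = v) //; apply: funext => j /=.
  by rewrite vcat_r vconsS.
have E' w : sat M (rename (fdef D f)
      (vcons (rshift (farity f) ord0) (@lshift (farity f) n.+1)))
      (vcat w (vcons a v)) <-> fint B w = a.
  rewrite sat_rename comp_vcons vcat_r vcons0 (MB.1 f).
  by rewrite (_ : _ \o _ = w) //; apply: funext => j /=; rewrite vcat_l.
split=> [[w] | Ha].
  rewrite sat_And sat_bigand => -[H /E' <-] /=.
  by congr fint; apply: funext => i; apply/E.
exists (fun i => eval B v (ts i)); split; last exact/E'.
by apply/sat_bigand => i; apply/E.
Qed.

(** [M] and [B] share their domain, so connectives and quantifiers translate to themselves; an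
    atomic formula is handled by existentially naming the values of its terms. *)
Lemma sat_translate n (p : form tau n) v : sat M (translate p) v = sat B p v.
Proof.
elim: p v => {n} //=.
- move=> n s t v; apply: propext; split=> [[a []]|e].
    by rewrite !sat_tgraph => -> ->.
  by exists (eval B v t); rewrite !sat_tgraph.
- move=> n r ts v.
  apply: propext; rewrite sat_exn.
  have E w i : sat M (rename (tgraph (ts i)) (vcons (lshift n i) (@rshift (rarity r) n)))
      (vcat w v) <-> eval B v (ts i) = w i.
    rewrite sat_rename comp_vcons vcat_l -sat_tgraph.
    by rewrite (_ : _ \o _ = v) //; apply: funext => j /=; rewrite vcat_r.
  have E' w : sat M (rename (rdef D r) (@lshift (rarity r) n)) (vcat w v) <-> rint B w.
    rewrite sat_rename (MB.2 r).
    by rewrite (_ : _ \o _ = w) //; apply: funext => j /=; rewrite vcat_l.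
  split=> [[w]|H].
    rewrite sat_And sat_bigand => -[H /E'].
    by rewrite (_ : w = fun i => eval B v (ts i)) //; apply: funext => i; apply/esym/E.
  exists (fun i => eval B v (ts i)); split; last exact/E'.
  by apply/sat_bigand => i; apply/E.
- by move=> n p IHp q IHq v; rewrite IHp IHq.
- by move=> n p IHp q IHq v; rewrite IHp IHq.
- by move=> n p IHp v; rewrite IHp.
- by move=> n p IHp v; apply: eq_forall => a; rewrite IHp.
- by move=> n p IHp v; apply: eq_exists => a; rewrite IHp.
Qed.

End Translation.

(** * Elementary extensions *)

Section Elementary.
Context (sg : signature) (A A' : Type) (M : structure sg A) (M' : structure sg A').
Context (e : A -> A') (He : elementary_embedding M M' e).

(** The universal closure of [p] is a sentence, so it transfers along [e]; it is written as [exn]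
    between two negations. *)
Lemma elementary_valid k (p : form sg k) :
  (forall v, sat M p v) -> forall v, sat M' p v.
Proof.
move=> Hp v; apply: contrapT => Np.
(* [exn] expects a variable count of the form [m + n]; [k + 0] is not convertible to [k], so [p] is
   first renamed. *)
pose r (i : 'I_k) := lshift 0 i.
pose s := Neg (@exn sg k 0 (Neg (rename p r))).
have Hs : sat M s (@vnil A).
  by rewrite /s /= sat_exn => -[w]; rewrite /= sat_rename; apply.
have := (He s (@vnil A)).1 Hs; apply; apply/sat_exn; exists v.
rewrite /= sat_rename (_ : _ \o r = v) //.
by apply: funext => i; rewrite /= vcat_l.
Qed.

Lemma elementary_equiv k (p q : form sg k) :
  (forall v, sat M p v <-> sat M q v) -> forall v, sat M' p v <-> sat M' q v.
Proof.
move=> pq v; have := @elementary_valid k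
  (And (Or (Neg p) q) (Or (Neg q) p)) _ v; case.
  by move=> w /=; have := pq w; case: (EM (sat M p w)); case: (EM (sat M q w)); tauto.
by move=> /= [np|Hq] [nq|Hp]; split.
Qed.

(** That [fdef D f] is the graph of an operation amounts to the validity of two formulas, existence
    and uniqueness of the value; both transfer to [M'], where choice picks the operation. *)
Lemma fo_reduct_by_ext (tau : signature) (D : definitions sg tau) (B : structure tau A) :
  fo_reduct_by D M B -> exists B' : structure tau A', fo_reduct_by D M' B'.
Proof.
move=> [Bf Br].
have ex f (v : 'I_(farity f) -> A') : exists a, sat M' (fdef D f) (vcons a v).
  apply: (@elementary_valid _ (Exists (fdef D f))) => w.
  by exists (fint B w); apply/Bf.
have un f (v : 'I_(farity f) -> A') a b :
    sat M' (fdef D f) (vcons a v) -> sat M' (fdef D f) (vcons b v) -> a = b.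
  (* [ra] and [rb] select from the tuple [(x, y, w)] the tuples [(x, w)] and [(y, w)]. *)
  pose ra : 'I_(farity f).+1 -> 'I_(farity f).+2 := vcons ord0 (lift ord0 \o lift ord0).
  pose rb : 'I_(farity f).+1 -> 'I_(farity f).+2 := lift ord0.
  have Ea A'' (x y : A'') (w : 'I_(farity f) -> A'') :
      vcons x (vcons y w) \o ra = vcons x w.
    rewrite comp_vcons vcons0; congr vcons.
    by apply: funext => i /=; rewrite !vconsS.
  have Eb A'' (x y : A'') (w : 'I_(farity f) -> A'') :
      vcons x (vcons y w) \o rb = vcons y w.
    by apply: funext => i /=; rewrite !vconsS.
  pose p := Or (Neg (And (rename (fdef D f) ra) (rename (fdef D f) rb)))
     (Eq (Var sg ord0) (Var sg (lift ord0 ord0))).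
  move=> Ha Hb.
  have: sat M' p (vcons a (vcons b v)).
    apply: elementary_valid => w; rewrite (vcons_eta w) (vcons_eta (w \o _)).
    rewrite /= !sat_rename Ea Eb !vconsS !vcons0.
    rewrite -!(Bf f).
    case: (EM (w ord0 = (w \o lift ord0) ord0)); first by right.
    by move=> ne; left => -[ea eb]; exact: ne (etrans (esym ea) eb).
  rewrite /= !sat_rename Ea Eb !vconsS !vcons0.
  by case=> // -[].
exists (Structure (fun f v => projT1 (cid (ex f v))) (fun r => sat M' (rdef D r))).
split=> // f v a /=; case: cid => b Hb /=.
by split=> [<-|Ha] //; apply: un Hb Ha.
Qed.

End Elementary.

Lemma elementary_translate sg tau (D : definitions sg tau) A A' (M : structure sg A)
    (M' : structure sg A') (e : A -> A') (B : structure tau A) (B' : structure tau A')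
    k (p : form sg k) (q : form tau k) :
  elementary_embedding M M' e -> fo_reduct_by D M B -> fo_reduct_by D M' B' ->
  (forall v, sat M p v <-> sat B q v) -> forall v, sat M' p v <-> sat B' q v.
Proof.
move=> He MB MB' pq v; rewrite -(sat_translate MB').
by apply: (elementary_equiv He) => w; rewrite (sat_translate MB).
Qed.

(** * Preservation *)

Section Preservation.
Context (sg : signature) (A : Type) (B : structure sg A) (h : A -> A).
Hypothesis Hh : endomorphism B h.

Lemma endomorphism_eval n v (t : term sg n) : h (eval B v t) = eval B (h \o v) t.
Proof.
elim: t => //= f ts IH; rewrite (Hh.1 f).
by congr fint; apply: funext => i /=.
Qed.

Lemma existential_positive_preserved n (p : form sg n) :
  existential_positive p -> preserves h (sat B p).
Proof.
elim: p => {n} //=.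
- by move=> n _ v.
- by move=> n s t _ v /=; rewrite -!endomorphism_eval => ->.
- move=> n r ts _ v /= /(Hh.2 r).
  by congr rint; apply: funext => i /=; rewrite endomorphism_eval.
- by move=> n p IHp q IHq /andP[/IHp Hp /IHq Hq] v /= [/Hp ? /Hq].
- by move=> n p IHp q IHq /andP[/IHp Hp /IHq Hq] v /= [/Hp|/Hq]; [left|right].
- by move=> n p IHp /IHp Hp v [a /Hp]; rewrite comp_vcons; exists (h a).
Qed.

Lemma positive_preserved n (p : form sg n) :
  surjective_map h -> positive p -> preserves h (sat B p).
Proof.
move=> surj; elim: p => {n} //=.
- by move=> n _ v.
- by move=> n s t _ v /=; rewrite -!endomorphism_eval => ->.
- move=> n r ts _ v /= /(Hh.2 r).
  by congr rint; apply: funext => i /=; rewrite endomorphism_eval.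
- by move=> n p IHp q IHq /andP[/IHp Hp /IHq Hq] v /= [/Hp ? /Hq].
- by move=> n p IHp q IHq /andP[/IHp Hp /IHq Hq] v /= [/Hp|/Hq]; [left|right].
- move=> n p IHp /IHp Hp v /= H b; have [a <-] := surj b.
  by have /Hp := H a; rewrite comp_vcons.
- by move=> n p IHp /IHp Hp v [a /Hp]; rewrite comp_vcons; exists (h a).
Qed.

End Preservation.

Lemma automorphism_sat sg A (B : structure sg A) (h : A -> A) n (p : form sg n) v :
  automorphism B h -> sat B p v <-> sat B p (h \o v).
Proof.
move=> [Hh [g [hK gK Hg]]]; elim: p v => {n} //=.
- by move=> n s t v; rewrite -!(endomorphism_eval Hh); split=> [->|/(can_inj hK)].
- move=> n r ts v; split=> [/(Hh.2 r)|/(Hg.2 r)].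
    by congr rint; apply: funext => i /=; rewrite (endomorphism_eval Hh).
  by congr rint; apply: funext => i /=; rewrite -(endomorphism_eval Hh) hK.
- by move=> n p IHp q IHq v; rewrite IHp IHq.
- by move=> n p IHp q IHq v; rewrite IHp IHq.
- by move=> n p IHp v; rewrite IHp.
- move=> n p IHp v; split=> H a.
    by rewrite -(gK a) -comp_vcons -IHp.
  by rewrite IHp comp_vcons.
- move=> n p IHp v; split=> -[a H].
    by exists (h a); rewrite -comp_vcons -IHp.
  by exists (g a); rewrite IHp comp_vcons gK.
Qed.

(** * Quotients *)

Section Quotient.
Context (T : Type) (R : T -> T -> Prop).
Hypotheses (Rrefl : forall x, R x x) (Rsym : forall x y, R x y -> R y x).
Hypothesis Rtrans : forall x y z, R x y -> R y z -> R x z.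

Definition quot : Type := {P : T -> Prop | exists x, P = R x}.

Definition qclass (x : T) : quot := exist _ (R x) (ex_intro _ x erefl).

Definition qrepr (q : quot) : T := projT1 (cid (proj2_sig q)).

Lemma qreprK q : qclass (qrepr q) = q.
Proof. by case: q => P e; apply: eq_exist; rewrite /qrepr /=; case: cid. Qed.

Lemma qclassE x y : qclass x = qclass y <-> R x y.
Proof.
split=> [/(congr1 (@proj1_sig _ _)) /= ->|xy]; first exact: Rrefl.
apply/eq_exist/funext => z; apply: propext.
by split; apply: Rtrans => //; apply: Rsym.
Qed.

Lemma qreprP x : R (qrepr (qclass x)) x.
Proof. by apply/qclassE; rewrite qreprK. Qed.

End Quotient.

(** * Ultrapowers *)

Section Ultrapower.
Context (sg : signature) (A : Type) (M : structure sg A) (a0 : A).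
Context (J : Type) (U : (J -> Prop) -> Prop) (FU : UltraFilter U).

Let UF : Filter U := @filter_filter _ _ (@ultra_proper _ _ FU).

Lemma ultra_not (S : J -> Prop) : U (fun j => ~ S j) <-> ~ U S.
Proof.
split=> [Un Us|Ns]; last by case: (in_ultra_setVsetC S FU).
apply: (filter_not_empty U); apply: filterS (filterI Un Us).
by move=> j [].
Qed.

Lemma ultra_and (S T : J -> Prop) : U (fun j => S j /\ T j) <-> U S /\ U T.
Proof.
split=> [H|[HS HT]]; last by apply: filterS (filterI HS HT).
by split; apply: filterS H => j [].
Qed.

Lemma ultra_or (S T : J -> Prop) : U (fun j => S j \/ T j) <-> U S \/ U T.
Proof.
split=> [H|[] H]; [|by apply: filterS H; left|by apply: filterS H; right].
apply: contrapT => /not_orP[/ultra_not NS /ultra_not NT].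
apply: (filter_not_empty U); apply: filterS (filterI H (filterI NS NT)).
by move=> j [[]] ? [].
Qed.

Definition ueq (f g : J -> A) : Prop := U (fun j => f j = g j).

Definition upow : Type := quot ueq.

Lemma ueq_refl f : ueq f f.
Proof. by apply: filterS filterT. Qed.

Lemma ueq_sym f g : ueq f g -> ueq g f.
Proof. by apply: filterS => j. Qed.

Lemma ueq_trans f g h : ueq f g -> ueq g h -> ueq f h.
Proof. by move=> fg gh; apply: filterS (filterI fg gh) => j [-> ->]. Qed.

Let ucl : (J -> A) -> upow := @qclass _ ueq.
Let uclE := qclassE ueq_refl ueq_sym ueq_trans.
Let ureprP := qreprP ueq_refl ueq_sym ueq_trans.

(** Symbols are interpreted through chosen representatives; another choice changes the coordinates
    only outside a set of [U]. *)
Definition upow_struct : structure sg upow := Structure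
  (fun f (v : 'I_(farity f) -> upow) => ucl (fun j => fint M (fun i => qrepr (v i) j)))
  (fun r v => U (fun j => rint M (fun i => qrepr (v i) j))).

Lemma ueq_tuple n (v w : 'I_n -> J -> A) (S : ('I_n -> A) -> Prop) :
  (forall i, ueq (v i) (w i)) -> U (fun j => S (v^~ j)) -> U (fun j => S (w^~ j)).
Proof.
move=> vw HS; have {}vw := filter_forall UF vw.
apply: filterS (filterI vw HS) => j [E].
by rewrite (_ : v^~ j = w^~ j) //; apply: funext.
Qed.

Lemma eval_upow n (v : 'I_n -> J -> A) (t : term sg n) :
  eval upow_struct (fun i => ucl (v i)) t = ucl (fun j => eval M (v^~ j) t).
Proof.
elim: t => //= f ts IH; apply/uclE.
have := @ueq_tuple _ (fun i j => eval M (v^~ j) (ts i))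
  (fun i j => qrepr (eval upow_struct (fun i => ucl (v i)) (ts i)) j).
move=> H; have {}H S := H S _; apply: ueq_sym.
pose w i j := eval M (v^~ j) (ts i).
have E : forall i, ueq (w i) (qrepr (eval upow_struct (fun i => ucl (v i)) (ts i))).
  by move=> i; rewrite IH; apply/ueq_sym/ureprP.
apply: filterS (filter_forall UF E) => j Ej.
by congr fint; apply: funext => i; apply: Ej.
Qed.

(** Łoś's theorem. The existential case chooses a witness at each index; the connectives are the
    ultrafilter laws, and the universal case is the existential one for [Neg p]. *)
Lemma los n (p : form sg n) (v : 'I_n -> J -> A) :
  sat upow_struct p (fun i => ucl (v i)) <-> U (fun j => sat M p (v^~ j)).
Proof.
have Evc m (f : J -> A) (w : 'I_m -> J -> A) :
    vcons (ucl f) (fun i => ucl (w i)) = fun i => ucl (vcons f w i).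
  by rewrite -(comp_vcons ucl).
have Evc' m (f : J -> A) (w : 'I_m -> J -> A) j :
    (vcons f w)^~ j = vcons (f j) (w^~ j).
  by apply: (comp_vcons (fun g : J -> A => g j)).
have EX m (q : form sg m.+1) (w : 'I_m -> J -> A) :
   (forall w, sat upow_struct q (fun i => ucl (w i)) <-> U (fun j => sat M q (w^~ j))) ->
   (exists a, sat upow_struct q (vcons a (fun i => ucl (w i)))) <->
   U (fun j => exists a, sat M q (vcons a (w^~ j))).
  move=> IH; split=> [[a]|H].
    rewrite -[a](qreprK) [vcons _ _]Evc IH; apply: filterS => j.
    by rewrite Evc'; exists (qrepr a j).
  have ch j : exists a, (exists b, sat M q (vcons b (w^~ j))) ->
      sat M q (vcons a (w^~ j)).
    by case: (EM (exists b, sat M q (vcons b (w^~ j)))) => [[b]|N]; [exists b|exists a0].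
  have [f Hf] := choice ch.
  by exists (ucl f); rewrite Evc IH; apply: filterS H => j; rewrite Evc' => /Hf.
elim: p v => {n}.
- by move=> n v; split=> // /(filter_not_empty U).
- by move=> n s t v; rewrite /= !eval_upow; split=> /uclE.
- move=> n r ts v.
  have E : forall i, ueq (fun j => eval M (v^~ j) (ts i))
     (qrepr (eval upow_struct (fun i => ucl (v i)) (ts i))).
    by move=> i; rewrite eval_upow; apply/ueq_sym/ureprP.
  split; first by apply: ueq_tuple => i; apply: ueq_sym.
  exact: (ueq_tuple E).
- by move=> n p IHp q IHq v; rewrite /= IHp IHq ultra_and.
- by move=> n p IHp q IHq v; rewrite /= IHp IHq ultra_or.
- by move=> n p IHp v; rewrite /= IHp ultra_not.
- move=> n p IHp v /=.
  have := EX _ (Neg p) v; rewrite /= => H.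
  have {}H := H (fun w => iff_trans (not_iff_compat (IHp w)) (iff_sym (ultra_not _))).
  have <- : (~ exists a, ~ sat upow_struct p (vcons a (fun i => ucl (v i)))) <->
    forall a, sat upow_struct p (vcons a (fun i => ucl (v i))).
    by split=> [N a|N [a]]; [apply: contrapT => Na; apply: N; exists a|apply].
  rewrite H -ultra_not; split; apply: filterS => j.
    by move=> N a; apply: contrapT => Na; apply: N; exists a.
  by move=> N [a]; apply.
- by move=> n p IHp v; apply: EX.
Qed.

Definition udiag (a : A) : upow := ucl (fun=> a).

Lemma udiag_elementary : elementary_embedding M upow_struct udiag.
Proof.
move=> n p v; rewrite (los p (fun i _ => v i)); split=> [H|H].
  by apply: filterS filterT.
by apply: contrapT => N; apply: (filter_not_empty U); apply: filterS H.
Qed.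

End Ultrapower.

(** * Realizing types *)

(* A formula whose variables are filled by parameters from [A] and by unknowns
   from [V]. *)
Record cond (sg : signature) (A V : Type) := Cond {
  carity : nat;
  cform : form sg carity;
  cargs : 'I_carity -> A + V
}.

Definition env (A A' V : Type) (e : A -> A') (s : V -> A') (x : A + V) : A' :=
  match x with inl a => e a | inr y => s y end.

Definition holds sg A A' V (N : structure sg A') (e : A -> A') (s : V -> A')
    (c : cond sg A V) : Prop :=
  sat N (cform c) (env e s \o @cargs _ _ _ c).

Definition finitely_satisfiable sg A V (M : structure sg A) (C : cond sg A V -> Prop) :=
  forall l : seq {classic cond sg A V}, (forall c, c \in l -> C c) ->
    exists s, forall c, c \in l -> holds M id s c.

Definition satisfiable sg A A' V (N : structure sg A') (e : A -> A')
    (C : cond sg A V -> Prop) :=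
  exists s, forall c, C c -> holds N e s c.

(** The sets of finite lists that contain a cone, that is all lists extending a given one, form a
    proper filter; any ultrafilter above it contains the set of lists through [x]. *)
Lemma cone_ultrafilter (T : Type) :
  exists U : (seq {classic T} -> Prop) -> Prop,
    UltraFilter U /\ forall x, U (fun l => x \in l).
Proof.
pose F (S : seq {classic T} -> Prop) :=
  exists l0 : seq {classic T}, forall l : seq {classic T}, {subset l0 <= l} -> S l.
have PF : ProperFilter F.
  split; first by move=> [l0 /(_ l0)]; apply.
  split; first by exists [::].
    move=> S S' [l0 H] [l0' H']; exists (l0 ++ l0') => l sl; split; [apply: H|apply: H'];
      by move=> x xl; apply: sl; rewrite mem_cat xl ?orbT.
  by move=> S S' SS' [l0 H]; exists l0 => l /H /SS'.
have [U [FU FsU]] := ultraFilterLemma PF.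
exists U; split=> // x; apply: FsU; exists [:: x] => l; apply; exact: mem_head.
Qed.

(** One ultrapower realizes all types: its indices are finite lists of pairs of a type and a
    condition, and at index [l] the type [C] solves only those of its conditions that [l] pairs with
    it. *)
Theorem realizing_extension sg A (M : structure sg A) (a0 : A) (V : Type) :
  exists (A' : Type) (N : structure sg A') (e : A -> A'),
    elementary_embedding M N e /\
    forall C : cond sg A V -> Prop, finitely_satisfiable M C -> satisfiable N e C.
Proof.
pose T := ((cond sg A V -> Prop) * cond sg A V)%type.
have [U [FU Ucone]] := cone_ultrafilter T.
exists (upow A U), (upow_struct M U), (@udiag A _ U); split.
  exact: (udiag_elementary M a0 FU).
move=> C fC.
have ch (l : seq {classic T}) : exists s : V -> A,
    forall (c : cond sg A V) (x : {classic T}),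
      C c -> x = (C, c) -> x \in l -> holds M id s c.
  pose P (x : {classic T}) := `[< x.1 = C /\ C x.2 >].
  have [|s Hs] := fC [seq (x.2 : {classic _}) | x <- l & P x].
    by move=> c /(@mapP {classic T})[x]; rewrite mem_filter => /andP[/asboolP[_ Cx] _] ->.
  exists s => c x Cc Ex xl; apply: Hs; apply/(@mapP {classic T}); exists x; last by rewrite Ex.
  by rewrite mem_filter xl andbT; apply/asboolP; rewrite Ex.
have [s Hs] := choice ch.
exists (fun y => qclass (ueq U) (fun l => s l y)) => c Cc.
rewrite /holds.
pose v (i : 'I_(carity c)) (l : seq {classic T}) := env id (s l) (@cargs _ _ _ c i).
have := los M a0 FU (cform c) v.
rewrite (_ : (fun i => qclass _ (v i)) =
  env (udiag U) (fun y => qclass (ueq U) (fun l => s l y)) \o @cargs _ _ _ c); last first.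
  by apply: funext => i; rewrite /= /v; case: (cargs i).
move=> ->; apply: filterS (Ucone (C, c)) => l cl.
exact: (Hs l c _ Cc erefl cl).
Qed.

(** * Unions of elementary chains *)

Lemma elementary_inj sg A A' (M : structure sg A) (N : structure sg A') (e : A -> A') :
  elementary_embedding M N e -> injective e.
Proof.
move=> He a b eab.
have := He 2 (Eq (Var sg ord0) (Var sg (lift ord0 ord0))) (vcons a (vcons b (@vnil A))).
by rewrite /= !vconsS !vcons0 => -[_ ->].
Qed.

Lemma elementary_fint sg A A' (M : structure sg A) (N : structure sg A') (e : A -> A') f v :
  elementary_embedding M N e -> e (fint M (f := f) v) = fint N (e \o v).
Proof.
move=> He.
have := He _ (Eq (Var sg ord0) (App (fun i => Var sg (lift ord0 i))))
  (vcons (fint M v) v).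
rewrite comp_vcons /= !vcons0 => -[H _].
have E T (x : T) (w : 'I_(farity f) -> T) : (fun i => vcons x w (lift ord0 i)) = w.
  by apply: funext => i; rewrite vconsS.
by rewrite !E in H; apply: H.
Qed.

Lemma elementary_comp sg A A' A'' (M : structure sg A) (M' : structure sg A')
    (M'' : structure sg A'') (e : A -> A') (e' : A' -> A'') :
  elementary_embedding M M' e -> elementary_embedding M' M'' e' ->
  elementary_embedding M M'' (e' \o e).
Proof. by move=> He He' n p v; rewrite (He n) (He' n). Qed.

Section Colimit.
Context (sg : signature) (D : nat -> Type) (S : forall n, structure sg (D n)).
Context (e : forall n, D n -> D n.+1).
Hypothesis He : forall n, elementary_embedding (S n) (S n.+1) (@e n).

(** All levels live in one sigma type, so that moving up the chain needs no transport between
    [D (k + n)] and other levels. *)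
Definition push (x : {n & D n}) : {n & D n} := existT D (projT1 x).+1 (e (projT2 x)).

Definition meets (x y : {n & D n}) := exists k l, iter k push x = iter l push y.

Lemma push_inj : injective push.
Proof.
move=> [n a] [m b] H; have [E] : n.+1 = m.+1 := congr1 (@projT1 _ _) H.
by case: m / E b H => b /(@existT_inj2 _ D) /= /(elementary_inj (@He n)) ->.
Qed.

Lemma iter_push1 k x : projT1 (iter k push x) = k + projT1 x.
Proof. by elim: k => //= k ->. Qed.

Lemma iter_push_inj k : injective (iter k push).
Proof. by elim: k => [|k IH] x y //= /push_inj /IH. Qed.

Lemma meets_refl x : meets x x. Proof. by exists 0, 0. Qed.

Lemma meets_sym x y : meets x y -> meets y x.
Proof. by move=> [k [l H]]; exists l, k. Qed.

Lemma meets_trans x y z : meets x y -> meets y z -> meets x z.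
Proof.
move=> [k [l H]] [k' [l' H']]; exists (k' + k), (l + l').
by rewrite !iterD H -H' -!iterD addnC.
Qed.

Definition colim : Type := quot meets.

Definition incl n (a : D n) : colim := qclass meets (existT D n a).

Let inclE := qclassE meets_refl meets_sym meets_trans.

Lemma incl_inj n : injective (@incl n).
Proof.
move=> a b /inclE[k [l H]].
have := congr1 (@projT1 _ _) H; rewrite !iter_push1 /= => /addIn E.
by move: H; rewrite E => /iter_push_inj /(@existT_inj2 _ D).
Qed.

Lemma inclS n (a : D n) : incl (e a) = incl a.
Proof. by apply/inclE; exists 0, 1. Qed.

Lemma incl_surj x : exists n (a : D n), incl a = x.
Proof.
exists (projT1 (qrepr x)), (projT2 (qrepr x)).
by rewrite -[RHS]qreprK; case: (qrepr x).
Qed.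

Lemma chain_embedding n m : n <= m -> exists g : D n -> D m,
  elementary_embedding (S n) (S m) g /\ forall a, incl (g a) = incl a.
Proof.
elim: m => [|m IH]; first by case: n => // _; exists id.
rewrite leq_eqVlt => /orP[/eqP E|/IH[g [Hg ig]]]; first by rewrite -E; exists id.
exists (@e m \o g); split; first exact: elementary_comp Hg (@He m).
by move=> a /=; rewrite inclS.
Qed.

Lemma incl_tuple k (v : 'I_k -> colim) : exists n (w : 'I_k -> D n), v = @incl n \o w.
Proof.
have [n Hn] := choice (fun i => incl_surj (v i)).
exists (\max_i n i).
suff /choice[w Hw] : forall i, exists b : D (\max_i n i), incl b = v i.
  by exists w; apply: funext => i; rewrite -Hw.
move=> i; have [a <-] := Hn i.
have [g [_ ig]] := chain_embedding (leq_bigmax i : n i <= \max_j n j).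
by exists (g a).
Qed.

Lemma common_level n m k (w : 'I_k -> D n) (w' : 'I_k -> D m) :
  @incl n \o w = @incl m \o w' ->
  exists N (g : D n -> D N) (g' : D m -> D N),
    [/\ elementary_embedding (S n) (S N) g, elementary_embedding (S m) (S N) g',
        (forall a, incl (g a) = incl a), (forall a, incl (g' a) = incl a)
      & g \o w = g' \o w'].
Proof.
move=> H; have [g [Hg ig]] := chain_embedding (leq_maxl n m).
have [g' [Hg' ig']] := chain_embedding (leq_maxr n m).
exists (maxn n m), g, g'; split=> //; apply: funext => i; apply: (@incl_inj (maxn n m)).
by rewrite /= ig ig' -[LHS]/((@incl n \o w) i) H.
Qed.

Lemma colim_fint_ex (f : fsym sg) (v : 'I_(farity f) -> colim) :
  exists x, forall n w, v = @incl n \o w -> x = incl (fint (S n) w).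
Proof.
have [n [w ->]] := incl_tuple v.
exists (incl (fint (S n) w)) => m w' /common_level[N [g [g' [Hg Hg' ig ig' E]]]].
by rewrite -ig -ig' (elementary_fint _ Hg) (elementary_fint _ Hg') E.
Qed.

Definition colim_struct : structure sg colim := Structure
  (fun f v => projT1 (cid (@colim_fint_ex f v)))
  (fun r v => exists n w, v = @incl n \o w /\ rint (S n) w).

Lemma colim_fint n f (w : 'I_(farity f) -> D n) :
  fint colim_struct (@incl n \o w) = incl (fint (S n) w).
Proof. by rewrite /=; case: cid => x /= H; apply: H. Qed.

Lemma incl_eval n k (w : 'I_k -> D n) (t : term sg k) :
  eval colim_struct (@incl n \o w) t = incl (eval (S n) w t).
Proof.
elim: t => // f ts IH.
exact: etrans (congr1 (@fint _ _ colim_struct f) (funext IH)) (colim_fint _).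
Qed.

(** The elementary chain theorem, by induction on formulas for all levels at once. In the quantifier
    cases an element of the union is brought to a common level with [w] by elementary maps of the
    chain. *)
Lemma incl_elementary n : elementary_embedding (S n) colim_struct (@incl n).
Proof.
move=> k p w; elim: p n w => {k} //.
- by move=> k s t n w /=; rewrite !incl_eval; split=> [->|/incl_inj].
- move=> k r ts n w; rewrite [sat colim_struct _ _]/(rint colim_struct _).
  rewrite (_ : (fun i => _) = @incl n \o (fun i => eval (S n) w (ts i))); last first.
    by apply: funext => i; rewrite incl_eval.
  split=> [H|[m [w' [/common_level[N [g [g' [Hg Hg' ig ig' E]]]] H]]]].
    by exists n, (fun i => eval (S n) w (ts i)).
  have := Hg' _ (Rel (r := r) (fun i => Var sg i)) w'.
  rewrite /= => -[/(_ H)]; rewrite -[fun i => g' _]/(g' \o w') -E => {}H _.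
  by apply/(Hg _ (Rel (r := r) (fun i => Var sg i))).
- by move=> k p IHp q IHq n w /=; rewrite IHp IHq.
- by move=> k p IHp q IHq n w /=; rewrite IHp IHq.
- by move=> k p IHp n w /=; rewrite IHp.
- move=> k p IHp n w; split=> H; last first.
    by move=> a; apply/IHp; rewrite comp_vcons.
  move=> x; have [m [b <-]] := incl_surj x.
  have [g [Hg ig]] := chain_embedding (leq_maxl n m).
  have [g' [Hg' ig']] := chain_embedding (leq_maxr n m).
  have /= /(_ (g' b)) := (Hg _ _ _).1 H; rewrite IHp comp_vcons ig'.
  by rewrite (_ : _ \o (_ \o _) = @incl n \o w) //; apply: funext => i /=.
- move=> k p IHp n w; split=> /= [[a]|[x]].
    by rewrite IHp comp_vcons; exists (incl a).
  have [m [b <-]] := incl_surj x => H.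
  have [g [Hg ig]] := chain_embedding (leq_maxl n m).
  have [g' [Hg' ig']] := chain_embedding (leq_maxr n m).
  apply: (Hg _ (Exists p) w).2; exists (g' b); rewrite IHp comp_vcons ig'.
  by rewrite (_ : _ \o (_ \o _) = @incl n \o w) //; apply: funext => i /=.
Qed.

End Colimit.

(** * Building the chain and its filtration by levels *)

Record pointed_structure (sg : signature) := PointedStructure {
  dom : Type;
  str : structure sg dom;
  pt : dom
}.

Section RealizingChain.
Context (sg : signature).

Definition realizing (l : pointed_structure sg)
    (x : {l' : pointed_structure sg & dom l -> dom l'}) : Prop :=
  elementary_embedding (str l) (str (projT1 x)) (projT2 x) /\
  forall C : cond sg (dom l) (nat * dom l) -> Prop,
    finitely_satisfiable (str l) C -> satisfiable (str (projT1 x)) (projT2 x) C.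

Lemma realizing_ex l : exists x, @realizing l x.
Proof.
have [A' [N [e [He Hr]]]] := realizing_extension (str l) (pt l) (nat * dom l)%type.
by exists (existT (fun l' => dom l -> dom l') (PointedStructure N (e (pt l))) e).
Qed.

(** The domain changes at each step, so the recursion runs over bundled structures; the carried
    point is the default required by the next ultrapower. *)
Fixpoint chain (l0 : pointed_structure sg) (n : nat) : pointed_structure sg :=
  if n is m.+1 then projT1 (projT1 (cid (realizing_ex (chain l0 m)))) else l0.

Definition chain_emb l0 n : dom (chain l0 n) -> dom (chain l0 n.+1) :=
  projT2 (projT1 (cid (realizing_ex (chain l0 n)))).

Lemma chain_realizing l0 n :
  @realizing (chain l0 n) (existT (fun l' => dom _ -> dom l') (chain l0 n.+1) (@chain_emb l0 n)).
Proof. by rewrite /chain_emb /=; case: cid => -[l' e]. Qed.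

End RealizingChain.

(* [L n] is the domain of the n-th member of the chain. The unknowns of a type over
   [L n] are indexed by countably many copies of [L n], so that there are enough of
   them when the structure is finite. *)
Record realizing_filtration sg (A : Type) (M : structure sg A) (L : nat -> A -> Prop) : Prop := {
  filtration_mono : forall n x, L n x -> L n.+1 x;
  filtration_exhaust : forall x, exists n, L n x;
  filtration_inhabited : forall n, exists x, L n x;
  filtration_tarski : forall n k (p : form sg k.+1) v, (forall i, L n (v i)) ->
    (exists a, sat M p (vcons a v)) -> exists a, L n a /\ sat M p (vcons a v);
  filtration_realize : forall n (C : cond sg A (nat * A) -> Prop),
    (forall c, C c -> forall i,
       match @cargs _ _ _ c i with inl a => L n a | inr y => L n y.2 end) ->
    (forall l : seq {classic cond sg A (nat * A)}, (forall c, c \in l -> C c) ->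
       exists s, (forall y, L n (s y)) /\ forall c, c \in l -> holds M id s c) ->
    exists s, (forall y, L n.+1 (s y)) /\ forall c, C c -> holds M id s c
}.

Theorem realizing_filtration_ex sg A (M : structure sg A) : inhabited A ->
  exists (A' : Type) (M' : structure sg A') (e : A -> A') (L : nat -> A' -> Prop),
    [/\ elementary_embedding M M' e, forall a, L 0 (e a) & realizing_filtration M' L].
Proof.
move=> [a0]; pose l0 := PointedStructure M a0.
pose D n := dom (chain l0 n); pose S n := str (chain l0 n).
have He n : elementary_embedding (S n) (S n.+1) (@chain_emb sg l0 n).
  exact: (chain_realizing l0 n).1.
pose M' := colim_struct He; pose inc n := @incl D (@chain_emb sg l0) n.
have Hinc n : elementary_embedding (S n) M' (inc n) by exact: incl_elementary.
pose L n x := exists a, inc n a = x.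
have Lmono n x : L n x -> L n.+1 x.
  by move=> [a <-]; exists (chain_emb a); apply: inclS.
exists (colim (@chain_emb sg l0)), M', (inc 0), L; split; [exact: (Hinc 0)|by move=> a; exists a|].
have Ltup n k (v : 'I_k -> colim (@chain_emb sg l0)) :
    (forall i, L n (v i)) -> exists w, v = inc n \o w.
  by move=> /choice[w Hw]; exists w; apply: funext => i; rewrite -Hw.
split=> //.
- by move=> x; have [n [a H]] := incl_surj x; exists n, a.
- by move=> n; exists (inc n (pt (chain l0 n))), (pt (chain l0 n)).
- move=> n k p v /Ltup[w ->] H.
  have /Hinc[a Ha] : sat M' (Exists p) (inc n \o w) by [].
  exists (inc n a); split; first by exists a.
  by rewrite -comp_vcons -Hinc.
move=> n C CL Cfin.
(* Unknowns are indexed by elements, so passing from the n-th member to the union moves the indices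
   as well as the parameters. *)
pose up (x : D n + nat * D n) := match x with
  | inl a => inl (inc n a) | inr (k, a) => inr (k, inc n a) end.
pose upc (c : cond sg (D n) (nat * D n)) := Cond (cform c) (up \o @cargs _ _ _ c).
have Cup c : C c -> exists c', upc c' = c.
  case: c => m p w /CL /= Hw.
  have /choice[w' Hw'] i : exists y, up y = w i.
    case: (w i) (Hw i) => [x [a <-]|[k x] /= [a <-]]; first by exists (inl a).
    by exists (inr (k, a)).
  exists (Cond p w'); rewrite /upc /=; congr Cond; exact: funext.
have [|s Hs] := (chain_realizing l0 n).2 (C \o upc).
  move=> l Hl; have [|s [sL Hs]] := Cfin [seq (upc c : {classic _}) | c <- l].
    by move=> c /(@mapP {classic _} {classic _})[c' /Hl H ->].
  have [s' Es] := choice sL.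
  exists (fun y => s' (y.1, inc n y.2)) => c cl; rewrite /holds Hinc.
  have := Hs (upc c) (map_f _ cl); rewrite /holds /=.
  congr sat; apply: funext => i /=.
  by case: (cargs i) => [a|[k a]] //=; rewrite Es.
have /choice[s' Hs'] (y : nat * colim (@chain_emb sg l0)) : exists z, L n.+1 z /\
    forall a, inc n a = y.2 -> z = inc n.+1 (s (y.1, a)).
  (* Unknowns indexed outside [L n] occur in no condition of [C]; they get a base point. *)
  case: (EM (L n y.2)) => [[a Ea]|N]; last first.
    exists (inc n.+1 (pt (chain l0 n.+1))); split; first by exists (pt (chain l0 n.+1)).
    by move=> a Ea; case: N; exists a.
  exists (inc n.+1 (s (y.1, a))); split; first by exists (s (y.1, a)).
  by move=> b Eb; rewrite (@incl_inj _ _ S _ He n a b) // -[LHS]/(inc n a) Ea -Eb.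
exists s'; split=> [y|c Cc]; first exact: (Hs' y).1.
have [c' Ec] := Cup c Cc; have := Hs c'; rewrite /= Ec => /(_ Cc).
rewrite /holds (Hinc n.+1) -Ec /=; congr sat; apply: funext => i /=.
case: (cargs i) => [a|[k a]] /=; first exact: inclS.
by rewrite ((Hs' _).2 a).
Qed.

(** * Back and forth along a realizing filtration *)

(** Classes of relations instead of formulas let the negations of a fragment be treated like the
    fragment itself. *)
Definition rel_class (A : Type) := forall n, (('I_n -> A) -> Prop) -> Prop.

(** What the forth step asks of a class: conjunctions combine finitely many demands, existential
    quantifiers express that they are solvable, and [class_sub] renames, identifies or adds
    variables. *)
Record ep_closed sg A (M : structure sg A) (R : rel_class A) : Prop := {
  class_def : forall n S, R n S -> exists p : form sg n, S = sat M p;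
  class_full : forall n, R n (fun=> True);
  class_and : forall n S T, R n S -> R n T -> R n (fun v => S v /\ T v);
  class_ex : forall n S, R n.+1 S -> R n (fun v => exists a, S (vcons a v));
  class_sub : forall n m (r : 'I_n -> 'I_m) S, R n S -> R m (fun v => S (v \o r))
}.

(** Transfer of the dual class along the converse of [P] is the contrapositive of transfer along
    [P]; it turns forth steps into back steps. *)
Definition dual_class A (R : rel_class A) : rel_class A :=
  fun n S => R n (fun v => ~ S v).

Definition transfers A (R : rel_class A) (P : A -> A -> Prop) : Prop :=
  forall n S (u u' : 'I_n -> A), R n S -> (forall i, P (u i) (u' i)) -> S u -> S u'.

Lemma transfers_dual A (R : rel_class A) P :
  transfers R P -> transfers (dual_class R) (fun x y => P y x).
Proof.
move=> TP n S u u' RS Pu Su; apply: contrapT => NS.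
exact: (TP n _ u' u RS Pu NS Su).
Qed.

Lemma dual_classK A (R : rel_class A) n S : dual_class (dual_class R) S = R n S.
Proof.
rewrite /dual_class; congr (R n); apply: funext => v.
exact: notK.
Qed.

Section BackAndForth.
Context (sg : signature) (A : Type) (M : structure sg A) (L : nat -> A -> Prop).
Hypothesis HL : realizing_filtration M L.

Lemma filtration_tarskin n m r (p : form sg (m + r)) v : (forall i, L n (v i)) ->
  (exists w, sat M p (vcat w v)) ->
  exists w : 'I_m -> A, (forall i, L n (w i)) /\ sat M p (vcat w v).
Proof.
move=> Lv; elim: m p => [|m IH] p [w Hw].
  by exists w; split=> // -[].
have [|w' [Lw' [a Ha]]] := IH (Exists p).
  exists (w \o lift ord0), (w ord0).
  by rewrite -vcat_vcons -vcons_eta.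
have Lwv i : L n (vcat w' v i) by rewrite /vcat; case: split.
have [|b [Lb Hb]] := filtration_tarski HL Lwv (p := p); first by exists a.
exists (vcons b w'); rewrite vcat_vcons; split=> // i.
by case: (unliftP ord0 i) => [j|] ->; rewrite ?vconsS ?vcons0.
Qed.

Section Class.
Context (R : rel_class A) (HR : ep_closed M R).

Lemma class_exn m r (S : ('I_(m + r) -> A) -> Prop) :
  R S -> R (fun v => exists w : 'I_m -> A, S (vcat w v)).
Proof.
elim: m S => [|m IH] S RS.
  rewrite (_ : (fun v => _) = S) //; apply: funext => v; apply: propext.
  by split=> [[w]|H]; [rewrite vcat0|exists (@vnil A); rewrite vcat0].
have := IH _ (class_ex HR RS).
congr R; apply: funext => v; apply: propext; split=> [[w [a H]]|[w H]].
  by exists (vcons a w); rewrite vcat_vcons.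
by exists (w \o lift ord0), (w ord0); rewrite -vcat_vcons -vcons_eta.
Qed.

Section Forth.
Context (P : A -> A -> Prop) (n : nat) (PL : forall x y, P x y -> L n y).
Hypothesis TP : transfers R P.

(** Solvability of [p] is itself a relation of [R], so it passes from [u] to [u']; since [u'] lies
    in [L n], the Tarski property puts the solution there too. Unknowns are indexed by elements, so
    [s] is a function of elements, not of positions. *)
Lemma transfers_solvable m r (p : form sg (m + r)) (y : 'I_m -> A) (u u' : 'I_r -> A) :
  R (sat M p) -> (forall i, P (u i) (u' i)) -> sat M p (vcat y u) ->
  exists s : A -> A, (forall x, L n (s x)) /\ sat M p (vcat (s \o y) u').
Proof.
move=> Rp Pu Hp.
(* Unknowns filling several variables are merged by sending each variable to the
   first one with the same value. *)
pose idx x := [pick j | `[< y j = x >]].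
pose k i := odflt i (idx (y i)).
have yk i : y (k i) = y i.
  by rewrite /k /idx; case: pickP => //= j /asboolP.
pose q := rename p (vcat (@lshift m r \o k) (@rshift m r)).
have Eq z v : sat M q (vcat z v) = sat M p (vcat (z \o k) v).
  rewrite sat_rename comp_vcat; congr (sat M p (vcat _ _)); apply: funext => i /=.
    by rewrite vcat_l.
  by rewrite vcat_r.
have Rq : R (fun v => exists z : 'I_m -> A, sat M q (vcat z v)).
  apply: class_exn; rewrite (_ : sat M q = fun v => sat M p (v \o vcat (@lshift m r \o k) (@rshift m r))).
    exact: (class_sub HR).
  by apply: funext => v; rewrite sat_rename.
have [|z [Lz Hz]] := @filtration_tarskin n m r q u' (fun i => PL (Pu i)).
  apply: (TP Rq Pu); exists y; rewrite Eq.
  by rewrite (_ : y \o k = y) //; apply: funext => i; apply: yk.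
have [x0 Lx0] := filtration_inhabited HL n.
exists (fun x => if idx x is Some j then z j else x0); split.
  by move=> x; case: (idx x).
move: Hz; rewrite Eq; congr (sat M p (vcat _ _)); apply: funext => i /=.
rewrite /k /idx; case: pickP => //= /(_ i) /asboolP; by case.
Qed.

(* A condition of the type realized by the forth step: unknowns [y] in [L n],
   and parameters [u'] matched by [P] with a tuple [u] for which the condition
   holds at [vcat y u]. *)
Definition pattern (c : cond sg A (nat * A)) m r (p : form sg (m + r))
    (y : 'I_m -> A) (u u' : 'I_r -> A) : Prop :=
  [/\ R (sat M p), forall i, L n (y i), forall i, P (u i) (u' i), sat M p (vcat y u)
    & c = Cond p (vcat (fun i => inr (0, y i)) (fun i => inl (u' i)))].

(** The unknown [(0, x)] stands for the future image of [x], so a solution of all demands yields the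
    map [g] of [forth]. *)
Definition demanded (c : cond sg A (nat * A)) : Prop :=
  exists m r p y u u', @pattern c m r p y u u'.

Lemma holds_pattern c m r p y u u' s :
  @pattern c m r p y u u' ->
  holds M id s c = sat M p (vcat (fun i => s (0, y i)) u').
Proof. by case=> _ _ _ _ ->; rewrite /holds /= comp_vcat. Qed.

(** Two demands become one by conjoining them over disjoint blocks of unknowns and parameters, so
    finite satisfiability reduces to a single demand. *)
Lemma demanded_conj (l : seq {classic cond sg A (nat * A)}) :
  (forall c, c \in l -> demanded c) ->
  exists c, demanded c /\ forall s, holds M id s c -> forall c', c' \in l -> holds M id s c'.
Proof.
elim: l => [|c l IH] Hl.
  have [p Ep] := class_def HR (class_full HR (0 + 0)).
  exists (Cond p (vcat (@vnil _) (@vnil _))); split=> //.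
  exists 0, 0, p, (@vnil A), (@vnil A), (@vnil A); split.
  - by rewrite -Ep; apply: (class_full HR).
  - by case.
  - by case.
  - by rewrite -Ep.
  - by congr (Cond p (vcat _ _)); apply: funext; case.
have [c2 [[m2 [r2 [p2 [y2 [u2 [u2' H2]]]]]] sc2]] :=
  IH (fun c' cl => Hl c' (mem_behead (s := c :: l) cl)).
have [m1 [r1 [p1 [y1 [u1 [u1' H1]]]]]] := Hl c (mem_head _ _).
pose m := m1 + m2; pose r := r1 + r2.
pose f1 : 'I_(m1 + r1) -> 'I_(m + r) :=
  vcat (@lshift m r \o @lshift m1 m2) (@rshift m r \o @lshift r1 r2).
pose f2 : 'I_(m2 + r2) -> 'I_(m + r) :=
  vcat (@lshift m r \o @rshift m1 m2) (@rshift m r \o @rshift r1 r2).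
have E1 T (y : 'I_m1 -> T) y' (u : 'I_r1 -> T) u' :
    vcat (vcat y y') (vcat u u') \o f1 = vcat y u.
  rewrite comp_vcat; congr vcat; apply: funext => i /=.
    by rewrite !vcat_l.
  by rewrite vcat_r vcat_l.
have E2 T y (y' : 'I_m2 -> T) u (u' : 'I_r2 -> T) :
    vcat (vcat y y') (vcat u u') \o f2 = vcat y' u'.
  rewrite comp_vcat; congr vcat; apply: funext => i /=.
    by rewrite vcat_l vcat_r.
  by rewrite !vcat_r.
pose p := And (rename p1 f1) (rename p2 f2).
have Ep : sat M p = fun v => sat M p1 (v \o f1) /\ sat M p2 (v \o f2).
  by apply: funext => v; rewrite /= !sat_rename.
pose c' := Cond p (vcat (fun i => inr (0, vcat y1 y2 i)) (fun i => inl (vcat u1' u2' i)))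
  : cond sg A (nat * A).
have H : pattern c' p (vcat y1 y2) (vcat u1 u2) (vcat u1' u2').
  case: H1 H2 => R1 L1 P1 S1 _ [R2 L2 P2 S2 _]; split=> //.
  - by rewrite Ep; apply: (class_and HR) => //; apply: (class_sub HR).
  - by move=> i; rewrite /vcat; case: split.
  - by move=> i; rewrite /vcat; case: split.
  - by rewrite Ep E1 E2.
exists c'; split; first by exists m, r, p, (vcat y1 y2), (vcat u1 u2), (vcat u1' u2').
move=> s; rewrite (holds_pattern s H) Ep.
rewrite (_ : (fun i => _) = vcat (fun i => s (0, y1 i)) (fun i => s (0, y2 i))); last first.
  exact: (comp_vcat (fun a => s (0, a))).
rewrite E1 E2 -(holds_pattern s H1) -(holds_pattern s H2) => -[h1 h2] c''.
by rewrite inE => /orP[/eqP ->|] //; apply: sc2.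
Qed.

(** One type over [L n] asks for the images of all elements of [L n] at once; it is finitely
    satisfiable by [transfers_solvable] and realized in [L n.+1]. *)
Lemma forth : exists g : A -> A, (forall x, L n.+1 (g x)) /\
  transfers R (fun x y => P x y \/ (L n x /\ y = g x)).
Proof.
have [|l Hl|s [Ls Hs]] := filtration_realize HL (n := n) (C := demanded).
- move=> c [m [r [p [y [u [u' [_ Ly Pu _ ->]]]]]]] i /=.
  by rewrite /vcat; case: split => j //=; apply: PL (Pu j).
- have [c [[m [r [p [y [u [u' H]]]]]] cl]] := demanded_conj Hl.
  have [Rp Ly Pu Hp _] := H.
  have [s [Ls Hs]] := transfers_solvable Rp Pu Hp.
  exists (fun y => s y.2); split=> [x|]; first exact: Ls.
  by apply: cl; rewrite (holds_pattern _ H).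
exists (fun x => s (0, x)); split=> [x|k S w w' RS Qw Sw]; first exact: Ls.
have [x0 Lx0] := filtration_inhabited HL n.
(* Positions already matched by [P] become parameters, listed by [ev]; the others become unknowns,
   and [f] routes each position to its block. *)
pose b i := `[< P (w i) (w' i) >].
pose r := #|b|.
pose ev (j : 'I_r) : 'I_k := enum_val j.
pose f i : 'I_(k + r) :=
  if [pick j | ev j == i] is Some j then rshift k j else lshift r i.
(* Matched positions also own an unknown, which [f] never reads; [x0] keeps it in [L n]. *)
pose y i := if b i then x0 else w i.
have evb i : b i -> exists j, ev j = i.
  by move=> bi; exists (enum_rank_in bi i); rewrite /ev enum_rankK_in.
have [p Ep] := class_def HR (class_sub HR f RS).
have Hc : pattern (Cond p (vcat (fun i => inr (0, y i)) (fun i => inl (w' (ev i)))))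
    p y (w \o ev) (w' \o ev).
  split=> //.
  - by rewrite -Ep; apply: (class_sub HR).
  - move=> i; rewrite /y; case: ifP => // /asboolP.
    by case: (Qw i) => // -[].
  - by move=> j /=; apply/asboolP/(enum_valP j).
  - rewrite -Ep (_ : _ \o f = w) //; apply: funext => i; rewrite /f /=.
    case: pickP => [j /eqP <-|N]; first by rewrite vcat_r.
    rewrite vcat_l /y; case: ifP => // /evb[j E].
    by move: (N j); rewrite E eqxx.
have := Hs _ (ex_intro _ k (ex_intro _ r (ex_intro _ p (ex_intro _ y
  (ex_intro _ (w \o ev) (ex_intro _ (w' \o ev) Hc)))))).
rewrite (holds_pattern _ Hc) -Ep; congr S; apply: funext => i; rewrite /f /=.
case: pickP => [j /eqP <-|N]; first by rewrite vcat_r.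
rewrite vcat_l /y; case: ifP => [/evb[j E]|].
  by move: (N j); rewrite E eqxx.
by move/asboolP; case: (Qw i) => [//|[_ ->]].
Qed.

End Forth.

End Class.

(** A forth and a back extension each climb one level, whence [n.+2]. The guard on the last clause
    lets one construction serve fragments with and without universal quantification. *)
Definition stage_spec R n (P Q : A -> A -> Prop) : Prop :=
  [/\ (forall x y, P x y -> Q x y), (forall x y, Q x y -> L n.+2 x /\ L n.+2 y),
      transfers R Q, (forall x, L n x -> exists y, Q x y)
    & ep_closed M (dual_class R) -> forall y, L n y -> exists x, Q x y].

Lemma back_and_forth_step (R : rel_class A) n P : ep_closed M R ->
  (forall x y, P x y -> L n x /\ L n y) -> transfers R P -> exists Q, stage_spec R n P Q.
Proof.
move=> HR PL TP; have up := filtration_mono HL.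
have [g [Lg TP1]] := forth HR (fun x y Pxy => (PL x y Pxy).2) TP.
set P1 := (fun x y => _) in TP1.
have PL1 x y : P1 x y -> L n.+1 x /\ L n.+1 y.
  by case=> [/PL[] |[Lx ->]]; split=> //; apply: up.
case: (EM (ep_closed M (dual_class R))) => [HR'|N]; last first.
  exists P1; split=> // [x y Pxy|x y /PL1[]|x Lx].
  - by left.
  - by split; apply: up.
  - by exists (g x); right.
(* The back step is a forth step for the dual class along the converse of [P1]. *)
have [g' [Lg' TP2]] := forth HR' (fun y x Pxy => (PL1 x y Pxy).1) (transfers_dual TP1).
exists (fun x y => P1 x y \/ (L n.+1 y /\ x = g' y)); split.
- by move=> x y Pxy; left; left.
- move=> x y [/PL1[Lx Ly]|[Ly ->]]; split; by [apply: up|apply: Lg'].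
- by move=> m S u u' RS; apply: (transfers_dual TP2); rewrite dual_classK.
- by move=> x Lx; exists (g x); left; right.
- by move=> _ y Ly; exists (g' y); right; split=> //; apply: up.
Qed.

(** The union of the stages works because transfer concerns finite tuples, which lie in a single
    stage, and because stage [k.+1] covers [L (k.*2 + n)], levels that exhaust the structure. *)
Theorem back_and_forth (R : rel_class A) n P : ep_closed M R ->
  (forall x y, P x y -> L n x /\ L n y) -> transfers R P ->
  exists Q : A -> A -> Prop,
    [/\ forall x y, P x y -> Q x y, transfers R Q, forall x, exists y, Q x y
      & ep_closed M (dual_class R) -> forall y, exists x, Q x y].
Proof.
move=> HR PL TP; have up := filtration_mono HL.
have /choice[next Hnext] (kP : nat * (A -> A -> Prop)) : exists Q,
    (forall x y, kP.2 x y -> L kP.1 x /\ L kP.1 y) -> transfers R kP.2 ->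
    stage_spec R kP.1 kP.2 Q.
  case: (EM ((forall x y, kP.2 x y -> L kP.1 x /\ L kP.1 y) /\ transfers R kP.2)).
    by move=> [PL' TP']; have [Q HQ] := back_and_forth_step HR PL' TP'; exists Q.
  (* An arbitrary value: [choice] needs a next stage also for relations that are not admissible. *)
  by move=> N; exists kP.2 => PL' TP'; case: N.
pose fix st k := if k is j.+1 then next (j.*2 + n, st j) else P.
have inv k : (forall x y, st k x y -> L (k.*2 + n) x /\ L (k.*2 + n) y) /\
    transfers R (st k).
  elim: k => [|k [PL' TP']] //=.
  by have [_ QL TQ _ _] := Hnext (k.*2 + n, st k) PL' TP'.
have spec k : stage_spec R (k.*2 + n) (st k) (st k.+1).
  by have [] := inv k; apply: (Hnext (k.*2 + n, st k)).
have mono j k x y : j <= k -> st j x y -> st k x y.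
  move=> /subnK <-; elim: (k - j) => // d IH /IH.
  by case: (spec (d + j)) => H _ _ _ _; apply: H.
have Lmono j k x : j <= k -> L j x -> L k x.
  by move=> /subnK <-; elim: (k - j) => // d IH /IH /up.
have exh x : exists k, L (k.*2 + n) x.
  have [k Lk] := filtration_exhaust HL x; exists k; apply: Lmono Lk.
  by rewrite -addnn -addnA leq_addr.
exists (fun x y => exists k, st k x y); split.
- by move=> x y Pxy; exists 0.
- move=> m S u u' RS /choice[k Hk]; apply: ((inv (\max_i k i)).2 _ _ _ _ RS) => i.
  exact: mono (leq_bigmax i) (Hk i).
- move=> x; have [k Lx] := exh x; have [_ _ _ H _] := spec k.
  by have [y Hy] := H x Lx; exists y, k.+1.
- move=> HR' y; have [k Ly] := exh y; have [_ _ _ _ H] := spec k.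
  by have [x Hx] := H HR' y Ly; exists x, k.+1.
Qed.

End BackAndForth.

(** * Fragments of first-order logic *)

Record fragment (tau : signature) (F : forall n, form tau n -> Prop) : Prop := {
  fragment_bot : forall n, F n (Bot tau n);
  fragment_eq : forall n (s t : term tau n), F n (Eq s t);
  fragment_rel : forall n (r : rsym tau) (ts : 'I_(rarity r) -> term tau n), F n (Rel ts);
  fragment_and : forall n (p q : form tau n), F n p -> F n q -> F n (And p q);
  fragment_or : forall n (p q : form tau n), F n p -> F n q -> F n (Or p q);
  fragment_ex : forall n (p : form tau n.+1), F n.+1 p -> F n (Exists p);
  fragment_rename : forall n m (r : 'I_n -> 'I_m) (p : form tau n), F n p -> F m (rename p r)
}.

Definition fragment_definable tau (F : forall n, form tau n -> Prop) A
    (B : structure tau A) k (K : ('I_k -> A) -> Prop) : Prop :=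
  exists2 q : form tau k, F k q & defines B q K.

Lemma existential_positive_fragment tau :
  fragment (fun n (p : form tau n) => existential_positive p).
Proof.
split=> //= [n p q -> ->|n p q -> ->|n m r p] //.
by elim: p m r => {n} //= [n p IHp q IHq m r|n p IHp q IHq m r|n p IHp m r];
  by [move=> /andP[/IHp -> /IHq ->]|apply: IHp].
Qed.

Lemma positive_fragment tau : fragment (fun n (p : form tau n) => positive p).
Proof.
split=> //= [n p q -> ->|n p q -> ->|n m r p] //.
elim: p m r => {n} //= [n p IHp q IHq m r|n p IHp q IHq m r|n p IHp m r|n p IHp m r];
  by [move=> /andP[/IHp -> /IHq ->]|apply: IHp].
Qed.

Lemma fo_fragment tau : fragment (fun n (p : form tau n) => True).
Proof. by split. Qed.

(** * Undefinability and the relation class of a fragment *)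

Section Fragment.
Context (tau : signature) (F : forall n, form tau n -> Prop) (HF : fragment F).

Lemma fragment_top n : F (top tau n).
Proof. by apply: (fragment_ex HF); apply: (fragment_eq HF). Qed.

(* Induction on [m], with [X] and [K] varying: the points of [X] satisfying the
   last formula need only be separated from the points outside [K] that satisfy
   it too, and the others are separated by the remaining formulas. *)
Lemma fragment_interpolant A (B : structure tau A) (a0 : A) k (s : nat -> form tau k) m
    (X K : ('I_k -> A) -> Prop) :
  (forall i, i < m -> F (s i)) ->
  (forall a b, X a -> ~ K b -> exists2 i, i < m & sat B (s i) a /\ ~ sat B (s i) b) ->
  exists2 q, F q & (forall v, X v -> sat B q v) /\ (forall v, sat B q v -> K v).
Proof.
elim: m X K => [|m IH] X K Fs sep.
  case: (EM (exists a, X a)) => [[a Xa]|N].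
    exists (top tau k); first exact: fragment_top.
    split=> [v _|v _]; first by exists a0.
    by apply: contrapT => Nv; have [] := sep a v Xa Nv.
  by exists (Bot tau k); [exact: (fragment_bot HF)|split=> // v Xv; case: N; exists v].
have Fs' i : i < m -> F (s i) by move=> /ltnW; apply: Fs.
have [|q1 Fq1 [Xq1 q1K]] := IH (fun v => X v /\ ~ sat B (s m) v) K Fs'.
  move=> a b [Xa Na] Nb; have [i + [si Nsi]] := sep a b Xa Nb.
  rewrite ltnS leq_eqVlt => /orP[/eqP E|im]; first by rewrite E in si.
  by exists i.
have [|q2 Fq2 [Xq2 q2K]] := IH (fun v => X v /\ sat B (s m) v)
    (fun v => K v \/ ~ sat B (s m) v) Fs'.
  move=> a b [Xa Sa] /not_orP[Nb /contrapT Sb]; have [i + [si Nsi]] := sep a b Xa Nb.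
  rewrite ltnS leq_eqVlt => /orP[/eqP E|im]; first by rewrite E in Nsi.
  by exists i.
exists (Or q1 (And (s m) q2)).
  apply: (fragment_or HF) => //; apply: (fragment_and HF) => //; exact: Fs.
split=> v /=.
  by case: (EM (sat B (s m) v)) => Sv Xv; [right; split=> //; apply: Xq2|left; apply: Xq1].
by case=> [/q1K|[Sv /q2K[]]].
Qed.

(** Otherwise the formulas of [l] separate [K] from its complement, and an interpolant between [K]
    and [K] itself would define it in [F]. *)
Lemma undefinable_pair A (B : structure tau A) (a0 : A) k (K : ('I_k -> A) -> Prop)
    (l : seq (form tau k)) :
  ~ fragment_definable F B K -> (forall i, i < size l -> F (nth (Bot tau k) l i)) ->
  exists a b, [/\ K a, ~ K b & forall i, i < size l ->
    sat B (nth (Bot tau k) l i) a -> sat B (nth (Bot tau k) l i) b].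
Proof.
move=> ND Fl; apply: contrapT => N; apply: ND.
have [|q Fq [Kq qK]] := fragment_interpolant (B := B) a0 (X := K) (K := K) Fl.
  move=> a b Ka Nb; apply: contrapT => N'; apply: N; exists a, b; split=> // i il Sa.
  by apply: contrapT => NSb; apply: N'; exists i.
by exists q => // v; split=> [/Kq|/qK].
Qed.

Definition fragment_class A (B : structure tau A) : rel_class A :=
  fun n S => exists2 q : form tau n, F q & S = sat B q.

Section Reduct.
Context (sg : signature) (D : definitions sg tau) (A : Type) (M : structure sg A).
Context (B : structure tau A) (MB : fo_reduct_by D M B) (a0 : A).

Lemma fragment_class_def n (S : ('I_n -> A) -> Prop) q :
  S = sat B q -> exists p : form sg n, S = sat M p.
Proof. by move=> ->; exists (translate D q); apply: funext => v; rewrite (sat_translate MB). Qed.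

Lemma fragment_class_closed : ep_closed M (fragment_class B).
Proof.
split.
- by move=> n S [q _]; apply: fragment_class_def.
- move=> n; exists (top tau n); first exact: fragment_top.
  by apply: funext => v; apply: propext; split=> // _; exists a0.
- by move=> n S T [p Fp ->] [q Fq ->]; exists (And p q) => //; apply: (fragment_and HF).
- by move=> n S [q Fq ->]; exists (Exists q) => //; apply: (fragment_ex HF).
- move=> n m r S [q Fq ->]; exists (rename q r); first exact: (fragment_rename HF).
  by apply: funext => v; rewrite sat_rename.
Qed.

(** De Morgan's laws: disjunctions in [F] give the conjunctions of the dual class, universal
    quantifiers its existential ones. *)
Lemma fragment_class_dual :
  (forall n (p : form tau n.+1), F p -> F (Forall p)) ->
  ep_closed M (dual_class (fragment_class B)).
Proof.
move=> Fall; have notE n (S : ('I_n -> A) -> Prop) q :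
    (fun v => ~ S v) = sat B q -> S = sat B (Neg q).
  by move=> E; apply: funext => v; rewrite /= -E notK.
split.
- by move=> n S [q _ /notE]; apply: fragment_class_def.
- move=> n; exists (Bot tau n); first exact: (fragment_bot HF).
  by apply: funext => v; apply: propext; split=> // H; apply: H.
- move=> n S T [p Fp /notE ->] [q Fq /notE ->]; exists (Or p q).
    exact: (fragment_or HF).
  apply: funext => v /=; apply: propext.
  by split=> [/not_andP[] /contrapT|[] ? []]; [left|right| |].
- move=> n S [q Fq /notE ->]; exists (Forall q); first exact: Fall.
  apply: funext => v /=; apply: propext; split=> [N a|H [a]]; last by apply.
  by apply: contrapT => Na; apply: N; exists a.
- move=> n m r S [q Fq /notE ->]; exists (rename q r); first exact: (fragment_rename HF).
  by apply: funext => v; rewrite sat_rename /= notK.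
Qed.

Lemma fragment_endomorphism h :
  (forall n (q : form tau n), F q -> preserves h (sat B q)) -> endomorphism B h.
Proof.
move=> Hh; split=> [f v|r v Hv].
  have := Hh _ (Eq (Var tau ord0) (App (fun i => Var tau (lift ord0 i)))) (fragment_eq HF _ _)
    (vcons (fint B v) v).
  rewrite comp_vcons /= !vcons0.
  have E T (x : T) (w : 'I_(farity f) -> T) : (fun i => vcons x w (lift ord0 i)) = w.
    by apply: funext => i; rewrite vconsS.
  by rewrite !E; apply.
exact: (Hh _ (Rel (fun i => Var tau i)) (fragment_rel HF _) v Hv).
Qed.

End Reduct.

(** * A map of the extension that violates an undefinable relation *)

Section Violation.
Context (sg : signature) (A A' : Type) (M : structure sg A) (M' : structure sg A').
Context (e : A -> A') (L : nat -> A' -> Prop) (a0 : A).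
Hypothesis He : elementary_embedding M M' e.
Hypothesis L0e : forall a, L 0 (e a).
Hypothesis HL : realizing_filtration M' L.
Context (D : definitions sg tau) (B : structure tau A) (B' : structure tau A').
Hypothesis MB : fo_reduct_by D M B.
Hypothesis MB' : fo_reduct_by D M' B'.
Context (k : nat) (K : ('I_k -> A) -> Prop) (p : form sg k) (pK : defines M p K).
Context (K' : ('I_k -> A') -> Prop) (pK' : defines M' p K').
Hypothesis K_undef : ~ fragment_definable F B K.

(** The pair realizes a type in [k + k] unknowns stating that [x] is in [K'], that [y] is not, and
    that each [F]-formula true at [x] is true at [y]; finitely many of these conditions are met in
    [M] by [undefinable_pair]. *)
Lemma undefinable_pair_ext : exists a b : 'I_k -> A',
  [/\ forall i, L 1 (a i), forall i, L 1 (b i), K' a, ~ K' b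
    & forall q : form tau k, F q -> sat B' q a -> sat B' q b].
Proof.
pose l := @lshift k k; pose r := @rshift k k.
(* The unknowns are told apart by their number; their common element [e a0] only has to lie in
   [L 0]. *)
pose w (j : 'I_(k + k)) : A' + nat * A' := inr (val j, e a0).
pose cK := Cond (And (rename p l) (Neg (rename p r))) w.
pose cF q := Cond (Or (Neg (rename (translate D q) l)) (rename (translate D q) r)) w.
pose C c := c = cK \/ exists2 q : form tau k, F q & c = cF q.
have [|s0 Hs0|s [Ls Hs]] := filtration_realize HL (n := 0) (C := C).
- by move=> c [->|[q _ ->]] i /=; apply: L0e.
- have [qs Fqs Hqs] : exists2 qs : seq (form tau k),
      forall i, i < size qs -> F (nth (Bot tau k) qs i) &
      forall c, c \in s0 -> c = cK \/
        exists2 i, i < size qs & c = cF (nth (Bot tau k) qs i).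
    elim: s0 Hs0 => [|c s0 IH] Hs0; first by exists [::].
    have [qs Fqs Hqs] := IH (fun c' cl => Hs0 c' (mem_behead (s := c :: s0) cl)).
    have [cE|[q Fq cE]] := Hs0 c (mem_head _ _).
      by exists qs => // c'; rewrite inE => /orP[/eqP ->|/Hqs] //; left.
    exists (q :: qs) => [[|i] //=|c']; first exact: Fqs.
    rewrite inE => /orP[/eqP ->|/Hqs[|[i il E]]]; first by right; exists 0.
      by left.
    by right; exists i.+1.
  have [a [b [Ka Kb Hab]]] := undefinable_pair a0 K_undef Fqs.
  exists (fun y => if insub y.1 is Some j then e (vcat a b (j : 'I_(k + k))) else e a0).
  split=> [y|c /Hqs]; first by case: insub.
  have E (q : form sg (k + k)) : holds M' id
      (fun y => if insub y.1 is Some j then e (vcat a b (j : 'I_(k + k))) else e a0)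
      (Cond q w) = sat M q (vcat a b).
    rewrite /holds /=; apply: propext; rewrite He.
    rewrite (_ : _ \o w = e \o vcat a b) //.
    by apply: funext => j; rewrite /= valK.
  have El : vcat a b \o l = a by apply: funext => i; rewrite /= vcat_l.
  have Er : vcat a b \o r = b by apply: funext => i; rewrite /= vcat_r.
  case=> [->|[i il ->]]; rewrite E /= !sat_rename El Er; first by rewrite -!pK.
  rewrite !(sat_translate MB).
  by case: (EM (sat B (nth (Bot tau k) qs i) a)) => [/(Hab i il)|]; [right|left].
pose t (j : 'I_(k + k)) := s (val j, e a0).
have E q : holds M' id s (Cond q w) = sat M' q t by [].
exists (t \o l), (t \o r); split=> [i|i| | |q Fq]; try exact: Ls.
- by have := Hs cK (or_introl erefl); rewrite E /= !sat_rename -!pK' => -[].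
- by have := Hs cK (or_introl erefl); rewrite E /= !sat_rename -!pK' => -[].
- have := Hs (cF q) (or_intror (ex_intro2 _ _ q Fq erefl)).
  by rewrite E /= !sat_rename !(sat_translate MB') => -[].
Qed.

Lemma fragment_violation : exists h : A' -> A',
  [/\ forall n (q : form tau n), F q -> preserves h (sat B' q),
      (forall n (q : form tau n.+1), F q -> F (Forall q)) -> surjective_map h
    & ~ preserves h K'].
Proof.
have [a [b [La Lb Ka Kb Hab]]] := undefinable_pair_ext.
pose P x y := exists i, x = a i /\ y = b i.
have TP : transfers (fragment_class B') P.
  (* The entries of [u] and [u'] are those of [a] and [b] at the same positions [j], possibly
     repeated, so [q] at [u] is [rename q j] at [a]. *)
  move=> n S u u' [q Fq ->] /choice[j Hj].
  have -> : u = a \o j by apply: funext => i; rewrite (Hj i).1.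
  have -> : u' = b \o j by apply: funext => i; rewrite (Hj i).2.
  move=> Ha; rewrite -sat_rename; apply: Hab; first exact: (fragment_rename HF).
  by rewrite sat_rename.
have [||Q [PQ TQ Qtot Qsurj]] := back_and_forth HL (n := 1) _ _ TP.
- exact: (fragment_class_closed MB' (e a0)).
- by move=> x y [i [-> ->]].
(* Transferring the equation [x = x] gives [y = y'], so [Q] is single-valued. *)
have Qfun x y y' : Q x y -> Q x y' -> y = y'.
  move=> Qy Qy'.
  pose q := Eq (Var tau (@ord0 1)) (Var tau (lift ord0 ord0)).
  have := TQ 2 (sat B' q) (vcons x (vcons x (@vnil A'))) (vcons y (vcons y' (@vnil A'))).
  rewrite /= !vconsS !vcons0; apply=> //.
    by exists q => //; apply: (fragment_eq HF).
  move=> i; case: (unliftP ord0 i) => [j|] ->; rewrite ?vcons0 // !vconsS.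
  by case: (unliftP ord0 j) => [[]|] // ->; rewrite !vcons0.
have /choice[h Hh] := Qtot.
exists h; split.
- by move=> n q Fq v; apply: (TQ _ (sat B' q)) => [|i]; [exists q|apply: Hh].
- move=> Fall y; have [x Qx] := Qsurj (fragment_class_dual MB' Fall) y.
  by exists x; apply: Qfun Qx.
- move=> /(_ a Ka); rewrite (_ : h \o a = b) //.
  by apply: funext => i; apply: (Qfun (a i)) => //; apply: PQ; exists i.
Qed.

End Violation.

End Fragment.

(** Preserving [x <> y] makes [h] injective, and preserving [Neg q] makes the inverse preserve
    [q]. *)
Lemma fo_preserving_automorphism tau A (B : structure tau A) h :
  (forall n (q : form tau n), preserves h (sat B q)) -> surjective_map h ->
  automorphism B h.
Proof.
move=> Hh /choice[g hg].
have hinj : injective h.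
  move=> x y hxy; apply: contrapT => N.
  have := Hh _ (Neg (Eq (Var tau (@ord0 1)) (Var tau (lift ord0 ord0))))
    (vcons x (vcons y (@vnil A))).
  by rewrite /= !vconsS !vcons0; apply.
split; first exact: (fragment_endomorphism (fo_fragment tau)) => n q _.
exists g; split=> // [x|]; first by apply: hinj; rewrite hg.
apply: (fragment_endomorphism (fo_fragment tau)) => n q _ v Hv; apply: contrapT => N.
apply: (Hh _ (Neg q) (g \o v) N).
by rewrite (_ : h \o (g \o v) = v) //; apply: funext => i /=.
Qed.

(** * The three characterizations *)

Theorem theoremB1 (sg : signature) (A : Type) (M : structure sg A)
    (A_nonempty : inhabited A) :
  exists (A' : Type) (M' : structure sg A') (e : A -> A'),
    elementary_embedding M M' e /\
    forall (tau : signature) (D : definitions sg tau) (B : structure tau A),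
      fo_reduct_by D M B ->
      exists B' : structure tau A',
        fo_reduct_by D M' B' /\
        forall (k : nat) (K : ('I_k -> A) -> Prop) (p : form sg k),
          defines M p K ->
          forall K' : ('I_k -> A') -> Prop,
            defines M' p K' ->
            [/\ ep_definable B K <->
                  (forall h : A' -> A', endomorphism B' h -> preserves h K'),
                pos_definable B K <->
                  (forall h : A' -> A', endomorphism B' h -> surjective_map h ->
                     preserves h K')
              & fo_definable B K <->
                  (forall h : A' -> A', automorphism B' h -> preserves h K')].
Proof.
have [A' [M' [e [L [He L0e HL]]]]] := realizing_filtration_ex M A_nonempty.
exists A', M', e; split=> // tau D B MB.
have [B' MB'] := fo_reduct_by_ext He MB.
exists B'; split=> // k K p pK K' pK'; have [a0] := A_nonempty.
(* A definition [q] of [K] in [B] agrees with [p] on [M], hence on the extension, so it also defines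
   [K'] in [B']. *)
have defK' q : defines B q K -> K' = sat B' q.
  move=> qK; apply: funext => v; apply: propext; rewrite pK'.
  by apply: (elementary_translate He MB MB') => w; rewrite -pK qK.
have violation F (HF : @fragment tau F) ND :=
  @fragment_violation tau F HF sg A A' M M' e L a0 He L0e HL D B B' MB MB' k K p pK K' pK' ND.
split; split.
- move=> [q qep /defK' ->] h Hh; exact: existential_positive_preserved.
- move=> H; apply: contrapT => ND.
  have [h [Hh _]] := violation _ (existential_positive_fragment tau) ND; apply; apply: H.
  exact: (fragment_endomorphism (existential_positive_fragment tau)).
- move=> [q qpos /defK' ->] h Hh surj; exact: positive_preserved.
- move=> H; apply: contrapT => ND.
  have [h [Hh surj]] := violation _ (positive_fragment tau) ND; apply; apply: H.
    exact: (fragment_endomorphism (positive_fragment tau)).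
  by apply: surj.
- by move=> [q /defK' ->] h Hh v; rewrite -automorphism_sat.
- move=> H; apply: contrapT => ND.
  have [|h [Hh surj]] := violation _ (fo_fragment tau).
    by move=> [q _ qK]; apply: ND; exists q.
  apply; apply: H; apply: fo_preserving_automorphism => [n q|]; first exact: Hh.
  exact: surj.
Qed.
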